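(* Let $T=(V,E)$ be a tree with $n$ nodes rooted at $v_1$ with leaf set $Y$, let $w\le u$ be real edge vectors, $c>0$ an edge cost vector, and $M\in\mathbb{R}$. The problem (MSPIT$_{BH}$) can be solved in $O(n)$ time by outputting $\hat w$ defined by $\hat w(e)=u(e)$ if $c(e)\le M$ and $\hat w(e)=w(e)$ if $c(e)>M$.
   Context: For each leaf $t_k$, $P_k$ is the edge set of the path from $v_1$ to $t_k$; for $f:E\to\mathbb{R}$, $f(P_k):=\sum_{e\in P_k}f(e)$. $H(a,b)=1$ if $a\neq b$ and $0$ otherwise. The problem (MSPIT$_{BH}$) is: maximize $D(\hat w):=\min_{t_k\in Y}\hat w(P_k)$ over $\hat w:E\to\mathbb{R}$ subject to $\max_{e\in E}c(e)H(\hat w(e),w(e))\le M$ and $w(e)\le\hat w(e)\le u(e)$ for all $e\in E$.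
   Formalization: The output is claimed to be optimal only when the problem has a feasible solution, equivalently when M ≥ 0 (for M < 0 no vector satisfies the cost constraint); the O(n)-time output of ŵ is claimed for every real M. *)

(* Defs.v *)
From HB Require Import structures.
From mathcomp Require Import all_boot all_order all_algebra.
From mathcomp Require Import reals.

Set Implicit Arguments.
Unset Strict Implicit.
Unset Printing Implicit Defensive.

Import Order.TTheory GRing.Theory Num.Theory.
Local Open Scope ring_scope.

Record tree (n : nat) := Tree {
  tedges : {set {set 'I_n}};
  tedges_card : forall e, e \in tedges -> #|e| = 2;
  tree_connected :
    forall x y, connect [rel a b | [set a; b] \in tedges] x y;
  (* [cycle] also accepts x - y - x, the closed walk along a single edge,
     hence the bound 2 *)
  tree_acyclic :
    forall p, ucycle [rel a b | [set a; b] \in tedges] p -> (size p <= 2)%N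
}.

Definition adj n (T : tree n) : rel 'I_n := [rel a b | [set a; b] \in tedges T].

Notation edge T := {e : {set 'I_ _} | e \in tedges T}.

Section RootedTree.
Variables (n : nat) (T : tree n) (r : 'I_n).

Definition simple_path_to (v : 'I_n) (p : seq 'I_n) : bool :=
  [&& path (adj T) r p, last r p == v & uniq (r :: p)].

Lemma simple_path_exists v : exists p, simple_path_to v p.
Proof.
have /connectP[p rp vE] := tree_connected T r v.
case: (shortenP rp) vE => p' rp' up' _ vE.
by exists p'; rewrite /simple_path_to rp' up' vE eqxx.
Qed.

(* the path from the root to v, without its first vertex r *)
Definition root_path (v : 'I_n) : seq 'I_n := xchoose (simple_path_exists v).

Definition path_edges (v : 'I_n) : {set edge T} :=
  [set e : edge T |
     val e \in pairmap (fun x y => [set x; y]) r (root_path v)].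

Definition is_child (x v : 'I_n) : bool :=
  adj T v x && (v \in r :: root_path x).

(* leaves of the rooted tree: a root of degree one is not a leaf, and the root
   of the one-node tree is *)
Definition leaves : {set 'I_n} := [set v | [forall x, ~~ is_child x v]].

End RootedTree.

Section Problem.
Variable R : realType.

Definition hamming (a b : R) : R := (a != b)%:R.

Definition seq_min (s : seq R) : R := \big[Num.min/head 0 s]_(x <- s) x.

Variables (n : nat) (T : tree n) (r : 'I_n).

Definition path_weight (f : edge T -> R) (v : 'I_n) : R :=
  \sum_(e in path_edges T r v) f e.

Definition root_leaf_distance (f : edge T -> R) : R :=
  seq_min [seq path_weight f t | t <- enum (leaves T r)].

Variables (w u c : edge T -> R) (M : R).

(* the terms are nonnegative as c > 0, so the unit 0 only matters when there is
   no edge *)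
Definition upgrade_cost (x : edge T -> R) : R :=
  \big[Num.max/0]_(e : edge T) (c e * hamming (x e) (w e)).

Definition feasible (x : edge T -> R) : Prop :=
  upgrade_cost x <= M /\ forall e, w e <= x e <= u e.

Definition optimal (x : edge T -> R) : Prop :=
  feasible x /\
  forall y, feasible y -> root_leaf_distance y <= root_leaf_distance x.

Definition solution (e : edge T) : R := if c e <= M then u e else w e.

(* For M < 0 the constraint on the upgrade cost cannot be met. *)
Lemma feasibleP :
  (forall e, w e <= u e) -> (exists x, feasible x) <-> 0 <= M.
Proof.
move=> wu; split=> [[x [+ _]]|M0].
  apply: le_trans; rewrite /upgrade_cost.
  by elim/big_rec: _ => // e y _ y0; rewrite le_max y0 orbT.
exists w; split=> [|e]; last by rewrite lexx wu.
rewrite /upgrade_cost big1_idem //= ?maxxx // => e _.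
by rewrite /hamming eqxx mulr0.
Qed.

End Problem.

(* Real random-access machine with unit-cost instructions. It has a file of
   integer registers, a file of real registers, an integer memory and a real
   memory, both addressed through integer registers, and an output tape of
   reals. Programs are finite and contain no real constant other than the
   naturals. *)
Inductive instr :=
| NConst (d k : nat)
| NAdd (d a b : nat)
| NSub (d a b : nat)
| NLoad (d a : nat)
| NStore (a s : nat)
| RConst (d k : nat)
| RAdd (d a b : nat)
| RSub (d a b : nat)
| RMul (d a b : nat)
| RDiv (d a b : nat)
| RLoad (d a : nat)
| RStore (a s : nat)
| ROut (s : nat)
| Jump (l : nat)
| NJumpLe (a b l : nat)
| RJumpLe (a b l : nat)
| Halt.

Definition program := seq instr.

Section Machine.
Variable R : realType.

Record state := State {
  pc : nat;
  nreg : nat -> nat;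
  rreg : nat -> R;
  nmem : nat -> nat;
  rmem : nat -> R;
  output : seq R
}.

Definition upd (A : Type) (f : nat -> A) (k : nat) (a : A) : nat -> A :=
  fun j => if j == k then a else f j.

(* running past the end of the program halts *)
Definition fetch (P : program) (s : state) : instr := nth Halt P (pc s).

Definition halted (P : program) (s : state) : bool :=
  if fetch P s is Halt then true else false.

Definition step (P : program) (s : state) : state :=
  let: State i N X mN mX o := s in
  match fetch P s with
  | NConst d k => State i.+1 (upd N d k) X mN mX o
  | NAdd d a b => State i.+1 (upd N d (N a + N b)%N) X mN mX o
  | NSub d a b => State i.+1 (upd N d (N a - N b)%N) X mN mX o
  | NLoad d a => State i.+1 (upd N d (mN (N a))) X mN mX o
  | NStore a b => State i.+1 N X (upd mN (N a) (N b)) mX o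
  | RConst d k => State i.+1 N (upd X d k%:R) mN mX o
  | RAdd d a b => State i.+1 N (upd X d (X a + X b)) mN mX o
  | RSub d a b => State i.+1 N (upd X d (X a - X b)) mN mX o
  | RMul d a b => State i.+1 N (upd X d (X a * X b)) mN mX o
  | RDiv d a b => State i.+1 N (upd X d (X a / X b)) mN mX o
  | RLoad d a => State i.+1 N (upd X d (mX (N a))) mN mX o
  | RStore a b => State i.+1 N X mN (upd mX (N a) (X b)) o
  | ROut a => State i.+1 N X mN mX (rcons o (X a))
  | Jump l => State l N X mN mX o
  | NJumpLe a b l => State (if (N a <= N b)%N then l else i.+1) N X mN mX o
  | RJumpLe a b l => State (if X a <= X b then l else i.+1) N X mN mX o
  | Halt => s
  end.

Definition init (mN : nat -> nat) (mX : nat -> R) : state :=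
  State 0 (fun=> 0%N) (fun=> 0) mN mX [::].

Definition computes_within
    (P : program) (mN : nat -> nat) (mX : nat -> R) (t : nat) (o : seq R) :=
  exists k, let s := iter k (step P) (init mN mX) in
    [/\ (k <= t)%N, halted P s & output s = o].

(* Input format: n, the root and the endpoints of the edges, listed in the order
   es, in the integer memory; M and the triples (w, u, c) of the edges, in the
   same order, in the real memory. The other cells are arbitrary. *)
Definition encodes n (T : tree n) (r : 'I_n) (w u c : edge T -> R) (M : R)
    (es : seq (edge T)) (mN : nat -> nat) (mX : nat -> R) : Prop :=
  [/\ perm_eq es (enum {: edge T}),
      mN 0%N = n, mN 1%N = r, mX 0%N = M
    & forall e : edge T, let i := index e es in
      (exists x y : 'I_n,
         [/\ val e = [set x; y], mN (2 * i + 2)%N = x & mN (2 * i + 3)%N = y]) /\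
      [/\ mX (3 * i + 1)%N = w e, mX (3 * i + 2)%N = u e
        & mX (3 * i + 3)%N = c e]].

End Machine.

(* Main.v *)
Require Import Defs.
From mathcomp Require Import all_boot all_order all_algebra.
From mathcomp Require Import reals zify.
Import Order.TTheory GRing.Theory Num.Theory.
Local Open Scope ring_scope.

(** Optimality: the objective is monotone in the weights, and the proposed
    weights dominate all feasible ones, because an edge with [c e > M] cannot
    be changed at all.  Running time: the program scans the edge list, and it
    must know the number of edges, which the input does not give; it is [n - 1],
    since joining every node but the root to a neighbour closer to the root
    gives [n - 1] edges that already connect the tree, and any further edge
    would close a cycle. *)

(** * Counting the edges of a tree *)

Section ParentEdges.
Variables (V : finType) (e : rel V) (r : V).
Hypothesis e_conn : forall x, connect e r x.

Lemma connect_walk_size x :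
  exists k, [exists p : k.-tuple V, path e r p && (last r p == x)].
Proof.
have /connectP[p rp xE] := e_conn x.
by exists (size p); apply/existsP; exists (in_tuple p); rewrite rp xE eqxx.
Qed.

Definition root_dist x : nat := ex_minn (connect_walk_size x).

Lemma root_dist_path p : path e r p -> (root_dist (last r p) <= size p)%N.
Proof.
move=> rp; rewrite /root_dist; case: ex_minnP => k _; apply.
by apply/existsP; exists (in_tuple p); rewrite rp eqxx.
Qed.

Lemma shortest_walk x :
  exists p, [/\ path e r p, last r p = x & size p = root_dist x].
Proof.
rewrite /root_dist; case: ex_minnP => k /existsP[p /andP[rp /eqP xE]] _.
by exists p; rewrite size_tuple.
Qed.

(** The last vertex but one of a shortest walk from [r] to [x] is such a [y]. *)
Lemma closer_neighbourP x : x != r ->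
  exists y, e y x && (root_dist y < root_dist x)%N.
Proof.
have [p [+ + <-]] := shortest_walk x.
case/lastP: p => [|p z] /=; first by move=> _ ->; rewrite eqxx.
rewrite rcons_path last_rcons size_rcons => /andP[rp ez] <- _.
by exists (last r p); rewrite ez ltnS root_dist_path.
Qed.

(** The default [x] is taken only at the root, since nothing is closer to the root than itself. *)
Definition parent x : V :=
  odflt x [pick y | e y x && (root_dist y < root_dist x)%N].

Lemma parentP x : x != r ->
  e (parent x) x /\ (root_dist (parent x) < root_dist x)%N.
Proof.
move=> /closer_neighbourP[y yP]; rewrite /parent.
by case: pickP => [z /andP[]//|/(_ y)]; rewrite yP.
Qed.

Definition parent_edges : {set {set V}} :=
  [set [set parent x; x] | x in [set~ r]].

(** If distinct [x] and [y] gave the same edge, each would be the parent of the other, hence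
    strictly closer to the root than the other. *)
Lemma parent_edge_inj : {in [set~ r] &, injective (fun x => [set parent x; x])}.
Proof.
move=> x y; rewrite !inE => /parentP[_ dx] /parentP[_ dy] /= E.
have: x \in [set parent y; y] by rewrite -E !inE eqxx orbT.
rewrite !inE => /orP[/eqP xE|/eqP//].
have: y \in [set parent x; x] by rewrite E !inE eqxx orbT.
rewrite !inE => /orP[/eqP yE|/eqP//].
by move: dx dy; rewrite -xE -yE => dx /(ltn_trans dx); rewrite ltnn.
Qed.

Lemma card_parent_edges : #|parent_edges| = #|V|.-1.
Proof. by rewrite card_in_imset ?cardsC1 //; apply: parent_edge_inj. Qed.

(** Strong induction on [root_dist] links every vertex to [r]; symmetry of the relation does the
    rest. *)
Lemma parent_edges_connect x y :
  connect [rel a b | [set a; b] \in parent_edges] x y.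
Proof.
have cr z : connect [rel a b | [set a; b] \in parent_edges] r z.
  have [k] := ubnP (root_dist z); elim: k z => // k IH z zk.
  have [->|zr] := eqVneq z r; first exact: connect0.
  have [_ dz] := parentP _ zr.
  apply: (connect_trans (IH _ (leq_trans dz zk))); apply: connect1 => /=.
  by apply/imsetP; exists z => //; rewrite !inE.
apply: connect_trans (cr y); rewrite sym_connect_sym // => a b.
by rewrite /= setUC.
Qed.

End ParentEdges.

Lemma card_tedges n (T : tree n) (r : 'I_n) : #|tedges T| = n.-1.
Proof.
have conn x : connect (adj T) r x by apply: tree_connected.
rewrite -[in RHS](card_ord n) -(card_parent_edges _ _ _ conn).
apply/eq_card; move=> f; apply/idP/idP => [fT|]; last first.
  by case/imsetP=> x + ->; rewrite !inE => /(parentP _ _ _ conn)[].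
apply: contraT => fN.
have /eqP/cards2P[x [y [xy fE]]] := tedges_card fT.
have /connectP[p xp yE] := parent_edges_connect _ _ _ conn x y.
case: (shortenP xp) yE => q xq uq _ yE.
(* The edge [f] closes the simple path [q] of parent edges into a cycle. The bound 2 on its size
   leaves two cases: [q] empty, so [x = y], or [q] a single vertex, so that [f] is itself a parent
   edge. *)
suff /tree_acyclic/= : ucycle (adj T) (x :: q).
  case: q xq yE uq => [|a [|b q]] //=; first by move=> _ yx; rewrite yx eqxx in xy.
  by move=> + ya; rewrite andbT -ya -fE (negPf fN).
apply/andP; split=> //=; rewrite rcons_path -yE.
apply/andP; split; last by rewrite /adj /= setUC -fE.
apply: sub_path xq => a b /= /imsetP[z + E].
by rewrite !inE /adj /= E => /(parentP _ _ _ conn)[].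
Qed.

(** * Monotonicity and optimality *)

Section Optimality.
Variable R : realType.

Lemma le_seq_min_map (A : Type) (f g : A -> R) (s : seq A) :
  (forall a, f a <= g a) -> seq_min (map f s) <= seq_min (map g s).
Proof.
move=> fg; rewrite /seq_min !big_map.
(* Each minimum starts from the head of its own list, so the two starting values must be compared as
   well. *)
have : head 0 (map f s) <= head 0 (map g s) by case: s => //= a s.
move=> le_head; elim/big_ind2: _ => // x1 x2 y1 y2 h1 h2.
by rewrite le_min !ge_min h1 h2 orbT.
Qed.

Variables (n : nat) (T : tree n) (r : 'I_n) (w u c : edge T -> R) (M : R).

Lemma le_root_leaf_distance (f g : edge T -> R) :
  (forall e, f e <= g e) -> root_leaf_distance r f <= root_leaf_distance r g.
Proof. by move=> fg; apply: le_seq_min_map => v; apply: ler_sum. Qed.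

(** The condition [0 <= M] accounts for the starting value 0 of the maximum. *)
Lemma upgrade_cost_leP (x : edge T -> R) : 0 <= M ->
  upgrade_cost w c x <= M <-> forall e, c e * hamming (x e) (w e) <= M.
Proof.
move=> M0; split=> [xM e|xM].
  by apply: le_trans xM; rewrite /upgrade_cost (bigD1 e) //= le_max lexx.
rewrite /upgrade_cost; elim/big_ind: _ => // a b aM bM.
by rewrite ge_max aM.
Qed.

Hypothesis wu : forall e, w e <= u e.

Lemma solution_feasible : 0 <= M -> feasible w u c M (solution w u c M).
Proof.
move=> M0; split=> [|e]; last by rewrite /solution; case: ifP; rewrite lexx wu.
apply/upgrade_cost_leP => // e; rewrite /solution /hamming.
case: ifP => cM; last by rewrite eqxx mulr0.
by case: (_ != _); rewrite ?mulr1 ?mulr0.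
Qed.

Lemma feasible_le_solution y :
  feasible w u c M y -> forall e, y e <= solution w u c M e.
Proof.
move=> yF e; have M0 : 0 <= M by apply/(feasibleP c M wu); exists y.
case: yF => /(upgrade_cost_leP _ M0) /(_ e) + /(_ e) /andP[_ yu].
rewrite /solution /hamming; case: ifP => // /negbT cM.
by case: eqVneq => [->//|_] /=; rewrite mulr1 (negPf cM).
Qed.

Lemma solution_optimal :
  (exists x, feasible w u c M x) -> optimal r w u c M (solution w u c M).
Proof.
move=> /(feasibleP c M wu) M0; split; first exact: solution_feasible.
by move=> y /feasible_le_solution; apply: le_root_leaf_distance.
Qed.

End Optimality.

(* Integer register 1 holds one more than the number of edges still to be
   scanned, 2 the constant 1, 3 the last address read in the real memory; real
   register 0 holds [M]. Integer register 0 keeps its initial value 0. *)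
Definition scan_program : program :=
  [:: NLoad 1 0; NConst 2 1; RLoad 0 0;
      NSub 1 1 2; NJumpLe 1 0 16;
      NAdd 3 3 2; RLoad 1 3; NAdd 3 3 2; RLoad 2 3; NAdd 3 3 2; RLoad 3 3;
      RJumpLe 3 0 14; ROut 1; Jump 3; ROut 2; Jump 3; Halt].

(** * Running time and output of the scan *)

Section ScanProgram.
Variables (R : realType) (A : Type) (w u c : A -> R) (M : R).

Let sol a := if c a <= M then u a else w a.

Section Runs.
Variables (N : nat -> nat) (X : nat -> R) (mN : nat -> nat) (mX : nat -> R).
Variable o : seq R.

(** A round of the loop is cut after each of its two branchings: 2 instructions test the counter, 7
    read an edge and compare its cost, 2 write, hence 11 per edge. With symbolic registers each
    block is settled by computation. *)
Lemma run_test :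
  iter 2 (step scan_program) (State 3 N X mN mX o) =
  State (if (N 1 - N 2 <= N 0)%N then 16 else 5) (upd N 1 (N 1 - N 2)%N)
    X mN mX o.
Proof. by []. Qed.

Lemma run_read (p := N 3%N) (q := N 2%N) :
  iter 7 (step scan_program) (State 5 N X mN mX o) =
  State (if mX (p + q + q + q)%N <= X 0%N then 14 else 12)
    (upd (upd (upd N 3 (p + q)%N) 3 (p + q + q)%N) 3 (p + q + q + q)%N)
    (upd (upd (upd X 1 (mX (p + q)%N)) 2 (mX (p + q + q)%N))
       3 (mX (p + q + q + q)%N))
    mN mX o.
Proof. by []. Qed.

Lemma run_write b :
  iter 2 (step scan_program) (State (if b then 14 else 12) N X mN mX o) =
  State 3 N X mN mX (rcons o (if b then X 2%N else X 1%N)).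
Proof. by case: b. Qed.

End Runs.

(** Loop invariant, by induction on the edges [s] still to be scanned: [i] edges have been read and
    [o] has been written. The extra 2 is the final, failing test. *)
Lemma scan_loop (s : seq A) (i : nat) N X mN (mX : nat -> R) o :
  N 0%N = 0%N -> N 1%N = (size s).+1 -> N 2%N = 1%N -> N 3%N = (3 * i)%N ->
  X 0%N = M ->
  (forall j a, onth s j = Some a ->
    [/\ mX (3 * (i + j) + 1)%N = w a, mX (3 * (i + j) + 2)%N = u a
      & mX (3 * (i + j) + 3)%N = c a]) ->
  exists k, let st := iter k (step scan_program) (State 3 N X mN mX o) in
    [/\ (k <= 11 * size s + 2)%N, halted scan_program st
      & output st = o ++ map sol s].
Proof.
elim: s i N X o => [|a s IH] i N X o N0 N1 N2 N3 X0 mXE.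
  by exists 2; rewrite run_test N0 N1 N2 /= cats0.
have [wE uE cE] := mXE 0%N a erefl; rewrite addn0 in wE uE cE.
set N' := upd N 1 (size s).+1.
have E : iter 11 (step scan_program) (State 3 N X mN mX o) =
    State 3
      (upd (upd (upd N' 3 (3 * i + 1)%N) 3 (3 * i + 2)%N) 3 (3 * i + 3)%N)
      (upd (upd (upd X 1 (w a)) 2 (u a)) 3 (c a)) mN mX (rcons o (sol a)).
  have N'2 : N' 2%N = 1%N by [].
  have N'3 : N' 3%N = (3 * i)%N by [].
  rewrite (iterD 9 2) run_test N1 N2 N0 subn1 ltn0 (iterD 2 7) run_read.
  by rewrite -[upd N 1 _]/N' N'2 N'3 X0 -!(addnA (3 * i)) wE uE cE run_write.
have [|||||j b sj|k [k_le st_halt st_out]] := IH i.+1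
  (upd (upd (upd N' 3 (3 * i + 1)%N) 3 (3 * i + 2)%N) 3 (3 * i + 3)%N)
  (upd (upd (upd X 1 (w a)) 2 (u a)) 3 (c a)) (rcons o (sol a)) => //.
- by rewrite /upd /= mulnS addnC.
- by have := mXE j.+1 b sj; rewrite addSnnS.
exists (k + 11)%N; rewrite iterD E; split=> //; first by move: k_le => /=; lia.
by rewrite st_out cat_rcons.
Qed.

(** The counter is decremented before each test, so it may start at one more than the number of
    edges. *)
Lemma scan_program_correct (s : seq A) mN (mX : nat -> R) :
  mN 0%N = (size s).+1 -> mX 0%N = M ->
  (forall j a, onth s j = Some a ->
    [/\ mX (3 * j + 1)%N = w a, mX (3 * j + 2)%N = u a
      & mX (3 * j + 3)%N = c a]) ->
  computes_within scan_program mN mX (11 * (size s).+1) (map sol s).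
Proof.
move=> n_val M_val mXE.
have [||||||k [k_le st_halt st_out]] := @scan_loop s 0
  (upd (upd (fun=> 0) 1 (mN 0)) 2 1)%N (upd (fun=> 0) 0 (mX 0%N)) mN mX [::] => //.
(* The 3 initial loads bring the total to at most [11 * size s + 5]. *)
exists (k + 3)%N; rewrite iterD; split=> //; lia.
Qed.

End ScanProgram.

Theorem theorem6 (R : realType) :
  exists (P : program) (C : nat),
  forall (n : nat) (T : tree n) (r : 'I_n) (w u c : edge T -> R) (M : R),
    (forall e, w e <= u e) ->
    (forall e, 0 < c e) ->
    ((exists x, feasible w u c M x) -> optimal r w u c M (solution w u c M)) /\
    (forall (es : seq (edge T)) (mN : nat -> nat) (mX : nat -> R),
       encodes r w u c M es mN mX ->
       computes_within P mN mX (C * n) [seq solution w u c M e | e <- es]).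
Proof.
exists scan_program, 11 => n T r w u c M wu c_gt0; split.
  exact: solution_optimal.
move=> es mN mX [es_perm n_val _ M_val esE].
have es_uniq : uniq es by rewrite (perm_uniq es_perm) enum_uniq.
have nE : n = (size es).+1.
  rewrite (perm_size es_perm) -cardE card_sig (card_tedges _ T r).
  (* The root [r] excludes [n = 0], where [n.-1.+1] differs from [n]. *)
  by case: n r {T w u c wu c_gt0 es mN mX es_perm n_val M_val esE es_uniq} => [[]|].
rewrite [in (11 * n)%N]nE; apply: scan_program_correct => // [|j e ej].
  by rewrite n_val.
(* The encoding locates an edge by its [index], the scan by its position [j]; they agree because
   [es] has no duplicates. *)
have j_lt : (j < size es)%N by rewrite -onthTE ej.
have <- : index e es = j by rewrite -{1}(onth_nth e _ _ _ ej) index_uniq.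
by have [] := esE e.
Qed.
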